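(* Let $(\phi^{(k)})_{k\ge1}$ be a sequence generated by the DC algorithm (defined in the context, with data $S,r,\epsilon$). Then any limit point of the sequence $(\phi^{(k)})$ is a first order stationary point of the problem of minimizing $f(\phi)=f_1(\phi)-f_2(\phi)$ over $\phi\in\mathcal{C}$.
   Context: Setting: $p\ge 1$, $1\le r\le p$, $\epsilon>0$, and $S=(s_{ij})\in\mathbb{R}^{p\times p}$ is symmetric positive semidefinite with strictly positive diagonal entries. For $\phi\in(0,\infty)^p$ put $\Phi=\mathrm{diag}(\phi_1,\dots,\phi_p)$, let $\lambda_1^*\ge\dots\ge\lambda_p^*$ be the eigenvalues of $\Phi^{1/2}S\Phi^{1/2}$, and define $f_1(\phi)=\sum_{i=1}^p(-\log\phi_i+s_{ii}\phi_i)$, $f_2(\phi)=-\sum_{i=1}^r(\log(\max\{1,\lambda_i^*\})-\max\{1,\lambda_i^*\}+1)$, $f=f_1-f_2$. Both $f_1$ and $f_2$ are convex on $(0,\infty)^p$. Let $\mathcal{C}=\{\phi\in\mathbb{R}^p:0<\phi_i\le\tfrac1\epsilon,\ i=1,\dots,p\}$. DC algorithm: start from any $\phi^{(1)}\in\mathcal{C}$; for $k\ge1$ let $\nabla_k=(\nabla_{k,1},\dots,\nabla_{k,p})$ be a subgradient of the convex function $f_2$ at $\phi^{(k)}$, and let $$\phi^{(k+1)}\in\arg\min_{\phi\in\mathcal{C}}\ \sum_{i=1}^p\big(-\log\phi_i+s_{ii}\phi_i-\nabla_{k,i}\phi_i\big).$$ The sequence is taken to be infinite (no stopping rule). A limit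 point is the limit in $\mathbb{R}^p$ of a convergent subsequence. First order stationary point: a point $\tilde\phi\in\mathcal{C}$ such that, for some subgradient $g$ of $f_2$ at $\tilde\phi$, $\tilde\phi\in\arg\min_{\phi\in\mathcal{C}}\{f_1(\phi)-\langle g,\phi-\tilde\phi\rangle\}$. *)

(* Defs.v *)
From HB Require Import structures.
From mathcomp Require Import all_boot all_order all_algebra.
From mathcomp Require Import polyrcf.
From mathcomp Require Import all_classical all_reals all_analysis.

Set Implicit Arguments.
Unset Strict Implicit.
Unset Printing Implicit Defensive.

Import Order.TTheory GRing.Theory Num.Theory.
Import numFieldNormedType.Exports.

Local Open Scope classical_set_scope.
Local Open Scope ring_scope.

Definition psd (R : realType) (p : nat) (S : 'M[R]_p) : Prop :=
  S^T = S /\ forall x : 'cV[R]_p, 0 <= (x^T *m S *m x) 0 0.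

(* Real eigenvalues with algebraic multiplicity, in nonincreasing order. For a
   symmetric matrix of size p this list has length p; [eigvalsE] below
   identifies it whenever the characteristic polynomial splits over R. *)
Definition eigvals (R : realType) (p : nat) (A : 'M[R]_p) : seq R :=
  sort >=%R (flatten [seq nseq (mup x (char_poly A)) x
                     | x <- rootsR (char_poly A)]).

Lemma eigvals_sorted (R : realType) (p : nat) (A : 'M[R]_p) :
  sorted >=%R (eigvals A).
Proof. by apply: sort_sorted => x y; exact: le_total. Qed.

Lemma perm_eigvals (R : realType) (p : nat) (A : 'M[R]_p) (s : seq R) :
  char_poly A = \prod_(x <- s) ('X - x%:P) -> perm_eq (eigvals A) s.
Proof.
move=> As; have A0 : char_poly A != 0 by exact/monic_neq0/char_poly_monic.
have muE x : mup x (char_poly A) = count_mem x s by rewrite As mu_prod_XsubC.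
have rE x : (x \in rootsR (char_poly A)) = (x \in s).
  by rewrite -(roots_on_rootsR A0) in_itv /= As root_prod_XsubC.
rewrite /eigvals perm_sort; apply/allP => x _ /=; apply/eqP.
rewrite count_flatten -map_comp.
rewrite (eq_map (g := fun y => ((y == x) * count_mem x s)%N)); last first.
  by move=> y /=; rewrite count_nseq /= muE; case: eqP => // ->.
rewrite sumnE big_map -big_distrl /= -big_mkcond /= sum1_count.
rewrite count_uniq_mem ?uniq_roots // rE.
by case: (boolP (x \in s)) => [_|/count_memPn ->]; rewrite ?mul1n ?muln0.
Qed.

Lemma eigvalsE (R : realType) (p : nat) (A : 'M[R]_p) (s : seq R) :
  char_poly A = \prod_(x <- s) ('X - x%:P) -> sorted >=%R s -> eigvals A = s.
Proof.
move=> /perm_eigvals As s_sorted.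
by apply: (sorted_eq _ _ (eigvals_sorted A) s_sorted As);
  [exact: ge_trans | exact: ge_anti].
Qed.

Section DC.
Context {R : realType} {p : nat}.
Implicit Types (S : 'M[R]_p) (phi g : 'rV[R]_p).

Definition orthant : set 'rV[R]_p := [set phi | forall i, 0 < phi 0 i].

Definition feasible (eps : R) : set 'rV[R]_p :=
  [set phi | forall i, 0 < phi 0 i /\ phi 0 i <= 1 / eps].

Definition sqrt_diag phi : 'M[R]_p := diag_mx (\row_i Num.sqrt (phi 0 i)).

(* Indexed from 0, so that [lam S phi i] is the (i+1)-th largest eigenvalue. *)
Definition lam S phi (i : nat) : R :=
  (eigvals (sqrt_diag phi *m S *m sqrt_diag phi))`_i.

Definition f1 S phi : R := \sum_i (- ln (phi 0 i) + S i i * phi 0 i).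

Definition f2 S (r : nat) phi : R :=
  - \sum_(i < r) (ln (Num.max 1 (lam S phi i)) - Num.max 1 (lam S phi i) + 1).

Definition inner (u v : 'rV[R]_p) : R := \sum_i u 0 i * v 0 i.

Definition subgradient (D : set 'rV[R]_p) (h : 'rV[R]_p -> R) phi g : Prop :=
  D phi /\ forall psi, D psi -> h phi + inner g (psi - phi) <= h psi.

Definition argmin (D : set 'rV[R]_p) (h : 'rV[R]_p -> R) : set 'rV[R]_p :=
  [set x | D x /\ forall y, D y -> h x <= h y].

(* [phi k] and [nabla k] are the iterate and the subgradient numbered k+1. *)
Definition dc_algorithm S (r : nat) (eps : R)
    (phi nabla : nat -> 'rV[R]_p) : Prop :=
  feasible eps (phi 0%N) /\
  forall k : nat,
    subgradient orthant (f2 S r) (phi k) (nabla k) /\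
    argmin (feasible eps)
      (fun psi => \sum_i (- ln (psi 0 i) + S i i * psi 0 i
                          - nabla k 0 i * psi 0 i)) (phi k.+1).

Definition limit_of_subsequence (u : nat -> 'rV[R]_p) (l : 'rV[R]_p) : Prop :=
  exists s : nat -> nat,
    {homo s : m n / (m < n)%N} /\ (fun j => u (s j)) @ \oo --> l.

Definition first_order_stationary S (r : nat) (eps : R) phi : Prop :=
  feasible eps phi /\
  exists g, subgradient orthant (f2 S r) phi g /\
    argmin (feasible eps) (fun psi => f1 S psi - inner g (psi - phi)) phi.

End DC.

(* Main.v *)
Require Import Defs.
From mathcomp Require Import all_boot all_order all_algebra.
From mathcomp Require Import complex lra.
From mathcomp Require Import all_classical all_reals all_analysis.

(** Each step gives, for every feasible [psi],
    [f (phi k.+1) + f2 (phi k) + <nabla k, psi - phi k> <= f1 psi].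
    With [psi := phi k], [f] decreases along the iterates, hence
    [f l <= f (phi k.+1)], and this bound needs no convergence of
    [phi k.+1 - phi k] to [0]. Since [f2] is bounded on bounded sets while
    [f1] blows up at the boundary of the orthant, the iterates stay in a
    compact box of the open orthant, so the subgradients are bounded. Along an
    ultrafilter refining the given subsequence they converge to some [g];
    passing to the limit in the displayed inequality and in the subgradient
    inequality shows that [l] is stationary with subgradient [g].

    The limits need only the continuity of [f2], not its convexity. The sorted
    eigenvalues are bounded by the trace, so they converge along the
    ultrafilter, and by continuity of the determinant their limits are the
    roots of the limiting characteristic polynomial. *)

Set Implicit Arguments.
Unset Strict Implicit.
Unset Printing Implicit Defensive.

Import Order.TTheory GRing.Theory Num.Theory.
Import numFieldNormedType.Exports.
Local Open Scope classical_set_scope.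
Local Open Scope ring_scope.

(** * Spectra of real symmetric and positive semidefinite matrices *)

Lemma char_poly_conj (F : fieldType) n (P D : 'M[F]_n) :
  P \in unitmx -> char_poly (invmx P *m D *m P) = char_poly D.
Proof.
move=> Pu; rewrite /char_poly /char_poly_mx !map_mxM /=.
set Q := map_mx polyC P; set Q' := map_mx polyC (invmx P).
have QQ : Q' *m Q = 1%:M by rewrite -map_mxM mulVmx // map_mx1.
have -> : 'X%:M - Q' *m map_mx polyC D *m Q =
    Q' *m ('X%:M - map_mx polyC D) *m Q.
  by rewrite mulmxBr mulmxBl mul_mx_scalar -scalemxAl QQ scalemx1.
by rewrite !det_mulmx mulrAC -det_mulmx QQ det1 mul1r.
Qed.

(** Over [R[i]] the matrix is Hermitian, hence unitarily diagonalizable with real spectrum; the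
    embedding of [R] is injective on polynomials, so the factorization descends. *)
Lemma char_poly_symmetric_split (R : realType) n (A : 'M[R]_n) :
  A^T = A -> exists s : seq R, char_poly A = \prod_(x <- s) ('X - x%:P).
Proof.
move=> symA; pose toC := (real_complex R : {rmorphism R -> R[i]}).
pose B := map_mx toC A.
have Bherm : B \is hermsymmx.
  apply: realsym_hermsym.
    apply/is_hermitianmxP; apply/matrixP => i j.
    by rewrite expr0 scale1r !mxE /= -[in LHS]symA mxE.
  by apply/mxOverP => i j; rewrite mxE complex_real.
have := hermitian_spectral_diag_real Bherm => /mxOverP Dreal.
have /orthomx_spectralP := hermitian_normalmx Bherm.
move: (spectral_diag B) Dreal (spectral_unit B) => d Dreal Pu BE.
exists [seq complex.Re (d 0 i) | i <- enum 'I_n].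
apply: (@map_inj_poly _ _ toC) => //; first exact: complexI.
rewrite map_char_poly -/B BE char_poly_conj //.
rewrite char_poly_trig ?diag_mx_is_trig // rmorph_prod /= big_map big_enum /=.
apply: eq_bigr => i _; rewrite mxE eqxx mulr1n.
by rewrite rmorphB /= map_polyX map_polyC /= [toC _]RRe_real.
Qed.

(** Compactness gives a cluster point, and an ultrafilter converges to each of its cluster points.
    This replaces repeated extraction of subsequences. *)
Lemma ultra_bounded_cvg (T : Type) (R : realType) (U : set_system T)
    (u : T -> R) (a b : R) :
  UltraFilter U -> (\forall t \near U, a <= u t <= b) ->
  exists l : R, u @ U --> l.
Proof.
move=> UU uab.
have [l [_ cl]] : `[a, b] `&` cluster (u @ U) !=set0.
  by apply: segment_compact; apply: filterS uab => t; rewrite /= in_itv.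
exists l => B Bl.
have [//|nUB] := in_ultra_setVsetC (u @^-1` B) UU.
have [x [/= nB /nB //]] := cl (~` B) B nUB Bl.
Qed.

Lemma eigvals_psd (R : realType) p (A : 'M[R]_p) : psd A ->
  [/\ size (eigvals A) = p,
      char_poly A = \prod_(x <- eigvals A) ('X - x%:P),
      \sum_(x <- eigvals A) x = \tr A &
      forall x, x \in eigvals A -> 0 <= x].
Proof.
move=> [symA posA]; have [s As] := char_poly_symmetric_split symA.
have As' : char_poly A = \prod_(x <- eigvals A) ('X - x%:P).
  by rewrite As; apply/perm_big; rewrite perm_sym; exact: perm_eigvals.
have sz : size (eigvals A) = p.
  by apply: succn_inj; rewrite -(size_prod_XsubC _ id) -As' size_char_poly.
split => //.
(* The trace is read off the coefficient just below the leading one, which exists only in positive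
   size. *)
- case: p => [|p] in A {symA posA As} As' sz *.
    by rewrite /mxtrace big_ord0 (size0nil sz) big_nil.
  by apply: oppr_inj; rewrite -char_poly_trace // As' -coefPn_prod_XsubC sz.
- move=> x xA.
  have : root (char_poly A) x by rewrite As' root_prod_XsubC.
  rewrite -eigenvalue_root_char => /eigenvalueP [v vA v0].
  (* For a left eigenvector [v], the quadratic form at [v^T] equals [x] times the squared norm of
     [v]. *)
  have := posA v^T; rewrite trmxK vA -scalemxAl mxE.
  have vv : 0 < (v *m v^T) 0 0.
    rewrite lt_def; apply/andP; split; last first.
      by rewrite mxE sumr_ge0 // => i _; rewrite mxE -expr2 sqr_ge0.
    apply: contra v0; rewrite mxE psumr_eq0; last first.
      by move=> i _; rewrite mxE -expr2 sqr_ge0.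
    move=> /allP vi; apply/eqP/rowP => i; rewrite mxE; apply/eqP.
    by have := vi i (mem_index_enum _); rewrite mxE -expr2 sqrf_eq0.
  by rewrite pmulr_lge0.
Qed.

Lemma psd_diag_ge0 (R : realType) p (S : 'M[R]_p) j : psd S -> 0 <= S j j.
Proof.
move=> [_ /(_ (delta_mx j 0))]; rewrite trmx_delta -rowE mxE (bigD1 j) //=.
rewrite big1 ?addr0 => [|k kj]; first by rewrite !mxE !eqxx mulr1.
by rewrite !mxE (negbTE kj) mulr0.
Qed.

Lemma psd_conj (R : realType) p (S D : 'M[R]_p) :
  psd S -> psd (D^T *m S *m D).
Proof.
move=> [symS posS]; split; first by rewrite !trmx_mul trmxK symS mulmxA.
by move=> x; have := posS (D *m x); rewrite trmx_mul !mulmxA.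
Qed.

Lemma psd_scaled (R : realType) p (S : 'M[R]_p) (phi : 'rV[R]_p) :
  psd S -> psd (sqrt_diag phi *m S *m sqrt_diag phi).
Proof. by move=> /(@psd_conj _ _ _ (sqrt_diag phi)); rewrite tr_diag_mx. Qed.

Lemma scaledE (R : realType) p (S : 'M[R]_p) (phi : 'rV[R]_p) i j :
  (sqrt_diag phi *m S *m sqrt_diag phi) i j =
  Num.sqrt (phi 0 i) * S i j * Num.sqrt (phi 0 j).
Proof. by rewrite mul_mx_diag mxE mul_diag_mx !mxE. Qed.

Lemma trace_scaled (R : realType) p (S : 'M[R]_p) (phi : 'rV[R]_p) :
  (forall i, 0 <= phi 0 i) ->
  \tr (sqrt_diag phi *m S *m sqrt_diag phi) = \sum_i S i i * phi 0 i.
Proof.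
move=> phi0; apply: eq_bigr => i _.
rewrite scaledE mulrAC -expr2 sqr_sqrtr //.
exact: mulrC.
Qed.

(** Nonnegative eigenvalues summing to the trace are each at most the trace. An index past the last
    eigenvalue reads the default [0], within the same bounds. *)
Lemma lam_bounds (R : realType) p (S : 'M[R]_p) (phi : 'rV[R]_p) i :
  psd S -> (forall i, 0 <= phi 0 i) ->
  0 <= lam S phi i <= \sum_i S i i * phi 0 i.
Proof.
move=> Spsd phi0.
have [sz _ trE pos] := eigvals_psd (psd_scaled phi Spsd).
rewrite -trace_scaled // -trE /lam.
set s := eigvals _ in trE pos *.
have s0 (t : seq R) : {subset t <= s} -> 0 <= \sum_(x <- t) x.
  by move=> ts; rewrite big_seq sumr_ge0 // => x /ts /pos.
have [ilt|ige] := ltnP i (size s); last by rewrite nth_default // lexx s0.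
have si := mem_nth 0 ilt; rewrite pos //= (big_rem _ si) /= lerDl s0 //.
exact: mem_rem.
Qed.

(** * Continuity of the sorted eigenvalues *)

Lemma char_poly_horner (R : comNzRingType) n (A : 'M[R]_n) x :
  (char_poly A).[x] = \det (x%:M - A).
Proof.
rewrite -[LHS]/(horner_eval x _) -det_map_mx; congr (\det _).
apply/matrixP => i j; rewrite !mxE /= horner_evalE.
by rewrite hornerD hornerN hornerC hornerMn hornerX.
Qed.

Lemma cvg_det (R : realType) (T : Type) (F : set_system T) n
    (M : T -> 'M[R]_n) (N : 'M[R]_n) :
  Filter F -> (forall i j, M t i j @[t --> F] --> N i j) ->
  \det (M t) @[t --> F] --> \det N.
Proof.
move=> FF MN; rewrite /determinant.
apply: cvg_big => // [|s _]; first exact: add_continuous.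
apply: cvgM; first exact: cvg_cst.
by apply: cvg_big => //; exact: mul_continuous.
Qed.

Lemma poly_eq_horner (R : numDomainType) (P Q : {poly R}) :
  (forall x, P.[x] = Q.[x]) -> P = Q.
Proof.
move=> PQ; apply/eqP; rewrite -subr_eq0; apply/eqP.
(* The naturals up to [size (P - Q)] are distinct roots, too many for a nonzero difference. *)
apply: (@roots_geq_poly_eq0 _ _ [seq i%:R | i <- iota 0 (size (P - Q)).+1]).
- by apply/allP => x _; rewrite rootE hornerD hornerN PQ subrr.
- by rewrite map_inj_uniq ?iota_uniq // => i j /eqP; rewrite eqr_nat => /eqP.
- by rewrite size_map size_iota ltnW.
Qed.

Lemma cvg_lam (R : realType) (T : Type) (U : set_system T) p (S : 'M[R]_p)
    (phi : T -> 'rV[R]_p) (l : 'rV[R]_p) (b : R) i :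
  UltraFilter U -> psd S ->
  (forall t i, 0 <= phi t 0 i <= b) ->
  (forall i, phi t 0 i @[t --> U] --> l 0 i) ->
  lam S (phi t) i @[t --> U] --> lam S l i.
Proof.
move=> UU Spsd phib phil.
have phi0 t j : 0 <= phi t 0 j by have /andP[] := phib t j.
have S0 j : 0 <= S j j := psd_diag_ge0 j Spsd.
have /choice [mu muE] (j : nat) :
    exists m : R, lam S (phi t) j @[t --> U] --> m.
  apply: (@ultra_bounded_cvg _ _ _ _ 0 (\sum_i S i i * b)).
  apply: nearW => t; have /andP[-> /le_trans->//] := lam_bounds j Spsd (phi0 t).
  by apply: ler_sum => k _; apply: ler_wpM2l => //; have /andP[] := phib t k.
have eigE t := eigvals_psd (psd_scaled (phi t) Spsd).
have sz t : size (eigvals (sqrt_diag (phi t) *m S *m sqrt_diag (phi t))) = p.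
  by have [] := eigE t.
suff eigl : eigvals (sqrt_diag l *m S *m sqrt_diag l) = mkseq mu p.
  rewrite /lam eigl; have [ip|pi] := ltnP i p.
    by rewrite nth_mkseq //; exact: muE.
  rewrite (@nth_default _ _ (mkseq _ _)) ?size_mkseq //.
  under eq_fun do rewrite nth_default ?sz //.
  exact: cvg_cst.
(* The order of the [mu j] is inherited in the limit. The factorization is checked at each [x],
   where both sides are limits of the same determinants. *)
apply: eigvalsE; last first.
  apply/(sortedP 0) => j; rewrite size_mkseq => jp.
  rewrite !nth_mkseq //; last exact: ltnW.
  rewrite /= -subr_ge0; apply: (cvgr_to_ge (cvgB (muE j) (muE j.+1))).
  apply: nearW => t; rewrite subr_ge0.
  have /sortedP -/(_ 0 j) :=
    eigvals_sorted (sqrt_diag (phi t) *m S *m sqrt_diag (phi t)).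
  by rewrite sz; apply.
apply: poly_eq_horner => x; rewrite char_poly_horner.
have sqrtl j : Num.sqrt (phi t 0 j) @[t --> U] --> Num.sqrt (l 0 j).
    have := @continuous_cvg _ R R U _ _ (@Num.sqrt R) _ _ (phil j).
  by apply; exact: sqrt_continuous.
have c1 : \det (x%:M - sqrt_diag (phi t) *m S *m sqrt_diag (phi t)) @[t --> U]
    --> \det (x%:M - sqrt_diag l *m S *m sqrt_diag l).
  apply: cvg_det => j k.
  under eq_fun do rewrite mxE [X in _ + X]mxE scaledE.
  rewrite mxE [X in _ + X]mxE scaledE.
  apply: cvgB; first exact: cvg_cst.
  apply: cvgM; last exact: sqrtl.
  apply: cvgM; first exact: sqrtl.
  exact: cvg_cst.
have c2 : \det (x%:M - sqrt_diag (phi t) *m S *m sqrt_diag (phi t)) @[t --> U]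
    --> \prod_(j < p) (x - mu j).
  rewrite (_ : (fun t => _) = fun t => \prod_(j < p) (x - lam S (phi t) j)).
    apply: cvg_big => // [|j _]; first exact: mul_continuous.
    by apply: cvgB; [exact: cvg_cst|exact: muE].
  apply/funext => t; have [_ cp _ _] := eigE t.
  rewrite -char_poly_horner cp horner_prod (big_nth 0) sz big_mkord.
  by apply: eq_bigr => j _; rewrite hornerXsubC.
rewrite horner_prod big_map -[in iota 0 p](subn0 p) big_mkord.
under eq_bigr do rewrite hornerXsubC.
exact: (cvg_unique (@Rhausdorff R) c1 c2).
Qed.

(** * Bounds and continuity of the objective *)

Lemma cvg_ln (R : realType) (T : Type) (F : set_system T) (u : T -> R)
    (a : R) :
  Filter F -> 0 < a -> u t @[t --> F] --> a -> ln (u t) @[t --> F] --> ln a.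
Proof.
move=> FF a0 ua; have := @continuous_cvg _ R R F _ _ (@ln R) _ _ ua.
by apply; exact: continuous_ln.
Qed.

(** With [m] the maximum of [1] and an eigenvalue, [0 <= m - 1 - ln m <= m - 1], and [m - 1] is at
    most that eigenvalue, hence at most the trace. *)
Lemma f2_bounds (R : realType) p (S : 'M[R]_p) r (phi : 'rV[R]_p) :
  psd S -> (forall i, 0 <= phi 0 i) ->
  0 <= f2 S r phi <= r%:R * \sum_i S i i * phi 0 i.
Proof.
move=> Spsd phi0; rewrite /f2 -sumrN; apply/andP; split.
  apply: sumr_ge0 => i _; set m := Num.max _ _.
  have m1 : 1 <= m by rewrite le_max lexx.
  have := @le_ln1Dx R (m - 1); rewrite addrCA subrr addr0.
  by move=> /(_ ltac:(lra)); lra.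
have -> : r%:R * \sum_i S i i * phi 0 i =
    \sum_(j < r) \sum_i S i i * phi 0 i.
  by rewrite sumr_const card_ord mulr_natl.
apply: ler_sum => i _; have /andP[l0 lb] := lam_bounds i Spsd phi0.
apply: le_trans lb; set m := Num.max _ _.
have m1 : 1 <= m by rewrite le_max lexx.
have ml : m - 1 <= lam S phi i by rewrite lerBlDr ge_max lerDr l0 lerDl ler01.
by have := ln_ge0 m1; lra.
Qed.

Lemma cvg_f2 (R : realType) (T : Type) (U : set_system T) p (S : 'M[R]_p) r
    (phi : T -> 'rV[R]_p) (l : 'rV[R]_p) (b : R) :
  UltraFilter U -> psd S ->
  (forall t i, 0 <= phi t 0 i <= b) ->
  (forall i, phi t 0 i @[t --> U] --> l 0 i) ->
  f2 S r (phi t) @[t --> U] --> f2 S r l.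
Proof.
move=> UU Spsd phib phil; apply: cvgN.
apply: cvg_big => // [|j _]; first exact: add_continuous.
have cm : Num.max 1 (lam S (phi t) j) @[t --> U] --> Num.max 1 (lam S l j).
  have cmax : {for lam S l j, continuous (fun x : R => Num.max 1 x : R)}.
    apply: (@continuous_max R R (cst 1) id); first exact: cst_continuous.
    exact: cvg_id.
  have laml := cvg_lam (i := j) UU Spsd phib phil.
  by have := @continuous_cvg _ R R U _ _ _ _ cmax laml; exact.
apply: cvgD; last exact: cvg_cst.
apply: cvgB => //; apply: cvg_ln => //.
by rewrite lt_max ltr01.
Qed.

Lemma cvg_f1 (R : realType) (T : Type) (F : set_system T) p (S : 'M[R]_p)
    (phi : T -> 'rV[R]_p) (l : 'rV[R]_p) :
  Filter F -> orthant l -> (forall i, phi t 0 i @[t --> F] --> l 0 i) ->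
  f1 S (phi t) @[t --> F] --> f1 S l.
Proof.
move=> FF l0 phil; apply: cvg_big => // [|j _]; first exact: add_continuous.
apply: cvgD; first by apply: cvgN; apply: cvg_ln => //; exact: l0.
by apply: cvgM; [exact: cvg_cst|exact: phil].
Qed.

Lemma cvg_inner (R : realType) (T : Type) (F : set_system T) p
    (u v : T -> 'rV[R]_p) (a b : 'rV[R]_p) :
  Filter F -> (forall i, u t 0 i @[t --> F] --> a 0 i) ->
  (forall i, v t 0 i @[t --> F] --> b 0 i) ->
  inner (u t) (v t) @[t --> F] --> inner a b.
Proof.
move=> FF ua vb; apply: cvg_big => // [|j _]; first exact: add_continuous.
by apply: cvgM; [exact: ua|exact: vb].
Qed.

(** * A priori bounds on subgradients and iterates *)

Lemma innerBr (R : realType) p (g u v : 'rV[R]_p) :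
  inner g (u - v) = inner g u - inner g v.
Proof. by rewrite -sumrB; apply: eq_bigr => i _; rewrite !mxE mulrBr. Qed.

Lemma subgradient_bound (R : realType) p (h : 'rV[R]_p -> R)
    (x g : 'rV[R]_p) (c b B : R) (i : 'I_p) :
  0 < c -> (forall j, c <= x 0 j <= b) ->
  (forall y : 'rV[R]_p, (forall j, 0 < y 0 j <= b + c) -> 0 <= h y <= B) ->
  subgradient orthant h x g -> `|g 0 i| <= B / (c / 2).
Proof.
move=> c0 xcb hB [xo sg]; have xj j := andP (xcb j).
(* Moving coordinate [i] by [c / 2] either way stays in the box where [0 <= h <= B], so the linear
   term is at most the oscillation [B]. *)
have step (d : R) : `|d| = c / 2 -> g 0 i * d <= B.
  move=> dE; pose y := x + d *: delta_mx 0 i.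
  have y_in j : 0 < y 0 j <= b + c.
    have [? ?] := xj j; rewrite !mxE eqxx /=.
    by move: dE; case: (j == i); case: (ger0P d) => ? dE;
      rewrite ?mulr1 ?mulr0; lra.
  have yo : orthant y by move=> j; have /andP[] := y_in j.
  have x_in j : 0 < x 0 j <= b + c by have [? ?] := xj j; lra.
  have := sg _ yo; have /andP[_] := hB _ y_in; have /andP[+ _] := hB _ x_in.
  rewrite /y addrAC subrr add0r /inner (bigD1 i) //= big1 => [|j ji].
    by rewrite !mxE !eqxx /= mulr1; lra.
  by rewrite !mxE (negbTE ji) andbF !mulr0.
rewrite ler_pdivlMr ?divr_gt0 //.
have c2 : `|c / 2| = c / 2 by rewrite ger0_norm //; lra.
case: (ger0P (g 0 i)) => _; first exact: step.
by rewrite mulNr -mulrN; apply: step; rewrite normrN.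
Qed.

Lemma f2_box (R : realType) p (S : 'M[R]_p) r (phi : 'rV[R]_p) b :
  psd S -> (forall i, 0 < phi 0 i <= b) ->
  0 <= f2 S r phi <= r%:R * \sum_i S i i * b.
Proof.
move=> Spsd phib.
have phi0 i : 0 <= phi 0 i by have /andP[/ltW] := phib i.
have /andP[-> /le_trans->//] := f2_bounds r Spsd phi0.
apply: ler_wpM2l => //; apply: ler_sum => i _.
by apply: ler_wpM2l; [exact: psd_diag_ge0|have /andP[] := phib i].
Qed.

(** Every summand of [f1] is at least [- |ln b|], so a bound on the sum bounds each [- ln (phi 0 i)]
    from above. *)
Lemma f1_barrier (R : realType) p (S : 'M[R]_p) (phi : 'rV[R]_p) (b M : R) :
  psd S -> (forall i, 0 < phi 0 i <= b) -> f1 S phi <= M ->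
  forall i, expR (- (M + \sum_(j < p) `|ln b|)) <= phi 0 i.
Proof.
move=> Spsd phib f1M i; have /andP[phi0 _] := phib i.
rewrite -[leRHS]lnK ?posrE // ler_expR lerNl.
have term j : - `|ln b| <= - ln (phi 0 j) + S j j * phi 0 j.
  have /andP[p0 pb] := phib j; have b0 := lt_le_trans p0 pb.
  have : ln (phi 0 j) <= ln b by rewrite ler_ln ?posrE.
  have := ler_norm (ln b); have := mulr_ge0 (psd_diag_ge0 j Spsd) (ltW p0).
  by lra.
move: f1M; rewrite /f1 (bigD1 i) //= [in X in _ -> X](bigD1 i) //=.
have : \sum_(j < p | j != i) - `|ln b| <=
    \sum_(j < p | j != i) (- ln (phi 0 j) + S j j * phi 0 j).
  by apply: ler_sum => j _; exact: term.
rewrite sumrN; have := normr_ge0 (ln b).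
have := mulr_ge0 (psd_diag_ge0 i Spsd) (ltW phi0).
set s1 := \sum_(j < p | _) _; set s2 := \sum_(j < p | _) _; by lra.
Qed.

(** * The DC iteration and its limit points *)

Lemma dc_step (R : realType) p (S : 'M[R]_p) r eps phi nabla k psi :
  dc_algorithm S r eps phi nabla -> feasible eps psi ->
  f1 S (phi k.+1) - f2 S r (phi k.+1) + f2 S r (phi k) +
    inner (nabla k) (psi - phi k) <= f1 S psi.
Proof.
move=> [_ /(_ k)[[_ sg] [feas amin]]] psiC.
have objE (y : 'rV[R]_p) :
    \sum_i (- ln (y 0 i) + S i i * y 0 i - nabla k 0 i * y 0 i) =
    f1 S y - inner (nabla k) y by exact: sumrB.
(* Optimality against [psi] is added to the subgradient inequality tested at [phi k.+1]; the linear
   terms in [phi k.+1] cancel. *)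
have := amin _ psiC; rewrite !objE => opt.
have := sg (phi k.+1) (fun i => (feas i).1).
rewrite !innerBr; move: opt.
move: (f1 S psi) (f1 S (phi k.+1)) (f2 S r (phi k)) (f2 S r (phi k.+1)).
move: (inner _ psi) (inner _ (phi k)) (inner _ (phi k.+1)).
by clear; move=> *; lra.
Qed.

Theorem proposition9 (R : realType) (p r : nat) (eps : R) (S : 'M[R]_p)
    (phi nabla : nat -> 'rV[R]_p) (l : 'rV[R]_p)
    (hp : (1 <= p)%N) (hr1 : (1 <= r)%N) (hrp : (r <= p)%N)
    (heps : 0 < eps) (hS : psd S) (hdiag : forall i : 'I_p, 0 < S i i)
    (hDC : dc_algorithm S r eps phi nabla)
    (hl : limit_of_subsequence phi l) :
  first_order_stationary S r eps l.
Proof.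
have feas k : feasible eps (phi k).
  by case: k => [|k]; [exact: hDC.1|have [_ []] := hDC.2 k].
have box k i : 0 < phi k 0 i <= 1 / eps by apply/andP; exact: feas.
pose f x := f1 S x - f2 S r x.
have fdec j k : (j <= k)%N -> f (phi k) <= f (phi j).
  elim: k => [|k IH]; first by rewrite leqn0 => /eqP->.
  rewrite leq_eqVlt => /orP[/eqP->//|/IH]; apply: le_trans.
  have := dc_step k hDC (feas k).
  by rewrite innerBr subrr addr0 -lerBrDr.
pose B b := r%:R * \sum_i S i i * b.
(* This is the barrier for the level [f (phi 0) + B (1 / eps)], which bounds [f1 = f + f2] along the
   iterates. *)
pose c := expR (- (f (phi 0%N) + B (1 / eps) + \sum_(j < p) `|ln (1 / eps)|)).
have c0 : 0 < c := expR_gt0 _.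
have cbox k i : c <= phi k 0 i <= 1 / eps.
  have /andP[_ ->] := box k i; rewrite andbT.
  apply: (f1_barrier hS (box k)).
  have /andP[_ f2B] := f2_box r hS (box k).
  rewrite -[f1 S _](subrK (f2 S r (phi k))).
  exact: lerD (fdec 0%N k (leq0n k)) f2B.
have phi0 k i : 0 <= phi k 0 i <= 1 / eps.
  by have /andP[/(le_trans (ltW c0))-> ->] := cbox k i.
have [s [s_incr s_l]] := hl.
(* [U] lives on iteration numbers, not on positions in the subsequence, so the successor [t.+1]
   makes sense along it. *)
have [U [UU sU]] := ultraFilterLemma (fmap_proper_filter s eventually_filter).
have phil i : phi t 0 i @[t --> U] --> l 0 i.
  have cvgU : phi @ U --> l by move=> A /s_l; exact: sU.
  have := @continuous_cvg _ _ _ U _ phi (fun M : 'rV[R]_p => M 0 i) l.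
  by apply => //; exact: coord_continuous.
have U_ge k : U [set t | (k <= t)%N].
  apply: sU; exists k => // n /= kn; apply: leq_trans kn _.
  elim: n => // n IH; exact: leq_ltn_trans IH (s_incr _ _ (ltnSn n)).
have lb i : c <= l 0 i <= 1 / eps.
  apply/andP; split.
    apply: (cvgr_to_ge (phil i)); apply: nearW => t.
    by have /andP[] := cbox t i.
  apply: (cvgr_to_le (phil i)); apply: nearW => t.
  by have /andP[] := cbox t i.
have l_feas : feasible eps l.
  by move=> i; have /andP[/(lt_le_trans c0)] := lb i.
have l_orthant : orthant l by move=> i; exact: (l_feas i).1.
have f1l : f1 S (phi t) @[t --> U] --> f1 S l by exact: cvg_f1.
have f2l := cvg_f2 (r := r) UU hS phi0 phil.
have fU : f (phi t) @[t --> U] --> f l by exact: cvgB f1l f2l.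
have fl k : f l <= f (phi k).
  apply: (cvgr_to_le fU); apply: filterS (U_ge k) => t.
  exact: fdec.
have /choice[g' g'E] (i : 'I_p) : exists m : R, nabla t 0 i @[t --> U] --> m.
  (* The test points may leave the feasible box but stay in the orthant, with coordinates at most
     [1 / eps + c]. *)
  pose b := B (1 / eps + c) / (c / 2).
  apply: (@ultra_bounded_cvg _ _ _ _ (- b) b); apply: nearW => t.
  rewrite -ler_norml; have [sg _] := hDC.2 t.
  apply: subgradient_bound c0 (cbox t) _ sg => y yb.
  exact: f2_box.
pose g := \row_i g' i.
have gE i : nabla t 0 i @[t --> U] --> g 0 i by rewrite mxE.
have innerl psi :
    inner (nabla t) (psi - phi t) @[t --> U] --> inner g (psi - l).
  apply: cvg_inner => // i; rewrite !mxE; under eq_fun do rewrite !mxE.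
  by apply: cvgB; [exact: cvg_cst|exact: phil].
split=> //; exists g; split.
  split=> // psi psi0.
  apply: (cvgr_to_le (cvgD f2l (innerl psi))); apply: nearW => t.
  by have [[_ +] _] := hDC.2 t; exact.
split=> // psi psiC; rewrite subrr.
(* Writing [f1 S l] as [f l + f2 S r l] gives the goal the shape of [dc_step], with the constant
   [f l] in place of [f (phi t.+1)]. *)
suff : f l + f2 S r l + inner g (psi - l) <= f1 S psi.
  have -> : inner g 0 = 0 by apply: big1 => i _; rewrite !mxE mulr0.
  by rewrite /f subrK oppr0 addr0 lerBrDr.
apply: (cvgr_to_le (cvgD (cvgD (cvg_cst (f l)) f2l) (innerl psi))).
apply: nearW => t; apply: le_trans (dc_step t hDC psiC).
by rewrite lerD2r lerD2r; exact: fl t.+1.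
Qed.
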